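(* Let $a,b\in\mathbb{R}$ with $0<a<b$, let $q\ge1$, $s\in(0,\frac1q)$ and $\lambda,\theta\in[0,1]$. Then $$\left|(1-\theta)A_\lambda(a^{s+1},b^{s+1})+\theta\,A_\lambda(b,a)^{s+1}-L_{s+1}(a,b)^{s+1}\right|$$ $$\le (b-a)\,A_1(\theta)^{1-\frac1q}(s+1)\Bigl\{\lambda^2\bigl[a^{sq}A_2(\theta,s)+A_\lambda(b,a)^{sq}A_3(\theta,s)\bigr]^{\frac1q}+(1-\lambda)^2\bigl[b^{sq}A_2(\theta,s)+A_\lambda(b,a)^{sq}A_3(\theta,s)\bigr]^{\frac1q}\Bigr\},$$ where $$A_1(\theta)=\theta^2-\theta+\tfrac12,\qquad A_2(\theta,s)=\frac{2\theta^{s+2}}{(s+1)(s+2)}-\frac{\theta}{s+1}+\frac{1}{s+2},$$ $$A_3(\theta,s)=\frac{2(1-\theta)^{s+2}}{(s+1)(s+2)}-\frac{1-\theta}{s+1}+\frac{1}{s+2}.$$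
   Context: For $\alpha\in[0,1]$ and $x,y\in\mathbb{R}$, the weighted arithmetic mean is $A_\alpha(x,y)=\alpha x+(1-\alpha)y$ (a notation distinct from the functions $A_1(\theta)$, $A_2(\theta,s)$, $A_3(\theta,s)$ defined in the claim). For $p\in\mathbb{R}\setminus\{-1,0\}$ and $x,y>0$ with $x\ne y$, the $p$-logarithmic mean is $L_p(x,y)=\left(\frac{y^{p+1}-x^{p+1}}{(p+1)(y-x)}\right)^{1/p}$. *)

(* Defs.v *)
From mathcomp Require Import all_boot all_order all_algebra.
From mathcomp Require Import all_classical all_reals all_analysis.
Set Implicit Arguments.
Unset Strict Implicit.
Unset Printing Implicit Defensive.
Import Order.TTheory GRing.Theory Num.Theory.
Local Open Scope ring_scope.

(** Built on MathComp-Analysis.  Real powers are [powR], which satisfies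
    [0 `^ r = 0] for [r != 0]; this matters for [theta `^ (s + 2)] at
    [theta = 0] and [(1 - theta) `^ (s + 2)] at [theta = 1]. *)

Section means.
Variable R : realType.
Implicit Types x y p theta s : R.

Definition weighted_mean (alpha x y : R) : R := alpha * x + (1 - alpha) * y.

(** Meaningful for [p] different from [-1] and [0], and distinct [x, y > 0];
    the quotient is then positive. *)
Definition log_mean p x y : R :=
  ((y `^ (p + 1) - x `^ (p + 1)) / ((p + 1) * (y - x))) `^ (1 / p).

Definition A1 theta : R := theta ^+ 2 - theta + 1 / 2.

Definition A2 theta s : R :=
  2 * theta `^ (s + 2) / ((s + 1) * (s + 2)) - theta / (s + 1) + 1 / (s + 2).

Definition A3 theta s : R :=
  2 * (1 - theta) `^ (s + 2) / ((s + 1) * (s + 2))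
  - (1 - theta) / (s + 1) + 1 / (s + 2).

End means.

(* Main.v *)
Require Import Defs.
From mathcomp Require Import all_boot all_order all_algebra.
From mathcomp Require Import all_classical all_reals all_analysis.
From mathcomp Require Import ring lra.
Import Order.TTheory GRing.Theory Num.Theory.
Import numFieldNormedType.Exports.
Local Open Scope ring_scope.

(** Put [c = weighted_mean lambda b a], so that [c - a = lambda (b - a)] and
    [b - c = (1 - lambda) (b - a)].  Splitting the integral of [x `^ (s + 1)]
    over [[a, b]] at [c] and integrating by parts bounds the left-hand side,
    times [b - a], by the sum over [x = a, b] of
      (s + 1) (x - c)^2 int_0^1 |t - theta| (c + t (x - c)) `^ s dt.
    The functions [A1], [A2], [A3] are the integrals over [[0, 1]] of
    [|t - theta|] against [1], [t `^ s], [(1 - t) `^ s].  Since [s q <= 1],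
    [(c + t (x - c)) `^ (s q) <= x `^ (s q) t `^ s + c `^ (s q) (1 - t) `^ s],
    and the power mean inequality with weight [|t - theta|] concludes.
    No integral is actually taken: all antiderivatives are explicit, and their
    increments on [[0, theta]] and [[theta, 1]] are compared by the mean value
    theorem. *)

(** * Tangent line bounds and subadditivity for real powers *)

Section PowerInequalities.
Variable R : realType.
Implicit Types x y r p : R.

Lemma powR_le_tangent1 y r :
  0 <= y -> 0 < r -> r <= 1 -> y `^ r <= 1 + r * (y - 1).
Proof.
move=> y0 r0; rewrite le_eqVlt => /predU1P[->|r1].
  by rewrite powRr1// mul1r subrKC.
have r1' : 0 < 1 - r by rewrite subr_gt0.
have := @conjugate_powR R (y `^ r) 1 r^-1 (1 - r)^-1 (powR_ge0 _ _) ler01.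
rewrite !invr_gt0 !invrK subrKC => /(_ r0 r1' erefl).
by rewrite mulr1 powR1 mul1r -powRrM divff ?gt_eqF// powRr1//; lra.
Qed.

Lemma powR_le_tangent x y r : 0 <= y -> 0 < x -> 0 < r -> r <= 1 ->
  y `^ r <= x `^ r * (1 - r) + r * x `^ r / x * y.
Proof.
move=> y0 x0 r0 r1.
have /(_ r r0 r1) := @powR_le_tangent1 (y / x) _ (divr_ge0 y0 (ltW x0)).
move=> /(ler_wpM2l (powR_ge0 x r)).
rewrite -powRM ?(ltW x0) ?divr_ge0 ?(ltW x0)// [x * _]mulrC divfK ?gt_eqF//.
by move=> /le_trans; apply; rewrite le_eqVlt; apply/orP; left; apply/eqP; ring.
Qed.

Lemma bernoulli_powR x p : 0 <= x -> 1 <= p -> 1 + p * (x - 1) <= x `^ p.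
Proof.
move=> x0 p1; have p0 : 0 < p by lra.
have := @powR_le_tangent1 (x `^ p) p^-1 (powR_ge0 _ _).
rewrite invr_gt0 invf_le1// => /(_ p0 p1).
rewrite -powRrM divff ?gt_eqF// powRr1// => h.
have : p * x <= p * (1 + p^-1 * (x `^ p - 1)) by rewrite ler_pM2l.
by rewrite mulrDr mulrA divff ?gt_eqF//; lra.
Qed.

Lemma powRD_le x y r : 0 <= x -> 0 <= y -> 0 < r -> r <= 1 ->
  (x + y) `^ r <= x `^ r + y `^ r.
Proof.
move=> x0 y0 r0 r1.
have [z0|z0] := leP (x + y) 0.
  have -> : x + y = 0 by lra.
  by rewrite powR0 ?gt_eqF// addr_ge0// powR_ge0.
(* The ratio [u / (x + y)] lies in [[0, 1]], hence is at most its [r]-th power; the ratios for [x]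
   and [y] sum to [1]. *)
have h u : 0 <= u -> u <= x + y -> u / (x + y) * (x + y) `^ r <= u `^ r.
  rewrite le_eqVlt => /predU1P[<- _|u0 uz]; first by rewrite !mul0r powR_ge0.
  rewrite -[in leRHS](divfK (lt0r_neq0 z0) u) [leRHS]powRM ?divr_ge0 ?(ltW u0) ?(ltW z0)//.
  apply: ler_wpM2r; first exact: powR_ge0.
  by apply: ger1_powR => //; rewrite divr_gt0// ler_pdivrMr// mul1r.
have hx : x <= x + y by lra.
have hy : y <= x + y by lra.
apply: le_trans (lerD (h _ x0 hx) (h _ y0 hy)).
by rewrite -mulrDl -mulrDl divff ?gt_eqF// mul1r.
Qed.

End PowerInequalities.

(** * Continuity and derivatives of powers, and comparison of increments *)

Section Calculus.
Variable R : realType.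
Implicit Types (f g : R -> R) (a b t p : R).

(* [0 < x -> x `^ p] jumps to [1] at negative arguments, hence the absolute
   value, which restores two-sided continuity at [0]. *)
Lemma continuous_norm_powR p : 0 < p -> continuous (fun t : R => `|t| `^ p).
Proof.
move=> p0 t; have [->|t0] := eqVneq t 0.
  rewrite /continuous_at normr0 powR0 ?gt_eqF//.
  apply/cvgr0Pnorm_lt => e e0.
  have := powR_gt0 p^-1 e0; move=> d0.
  near=> u.
  rewrite ger0_norm ?powR_ge0//.
  have -> : e = (e `^ p^-1) `^ p by rewrite -powRrM mulVf ?gt_eqF// powRr1// ltW.
  have ud : `|u| < e `^ p^-1.
    by near: u; apply: (cvgr0_norm_lt (fun u : R => u)) => //; exact: cvg_id.
  by rewrite gt0_ltr_powR ?nnegrE ?powR_ge0.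
have n0 : 0 < `|t| by rewrite normr_gt0.
apply: (@continuous_comp _ _ _ (fun t : R => `|t|) (fun y => y `^ p)).
  exact: norm_continuous.
apply/differentiable_continuous/derivable1_diffP.
exact: (@ex_derive _ _ _ _ _ _ _ (is_derive1_powR p n0)).
Unshelve. all: by end_near. Qed.

Lemma is_derive_norm_powR p t : 0 < t ->
  is_derive t 1 (fun t : R => `|t| `^ p) (p * t `^ (p - 1)).
Proof.
move=> t0; apply: (@near_eq_is_derive _ _ _ (fun t : R => t `^ p)).
  by apply: filterS (lt_nbhsr t0) => u /ltW u0; rewrite ger0_norm.
exact: is_derive1_powR.
Qed.

Lemma ler_increment f g df dg a b : a <= b ->
  continuous f -> continuous g ->
  (forall t, a < t < b -> is_derive t 1 f (df t)) ->
  (forall t, a < t < b -> is_derive t 1 g (dg t)) ->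
  (forall t, a < t < b -> df t <= dg t) ->
  f b - f a <= g b - g a.
Proof.
rewrite le_eqVlt => /predU1P[->|ab]; first by rewrite !subrr.
move=> cf cg Df Dg dfg.
have D t : t \in `]a, b[ -> is_derive t 1 (g - f) (dg t - df t).
  by rewrite in_itv/= => tab; apply: is_deriveB; [exact: Dg|exact: Df].
have [|c] := MVT ab D.
  apply: continuous_subspaceT => t; apply: continuousB; [exact: cg|exact: cf].
rewrite in_itv/= => /dfg cab; rewrite -![(_ - _ : _ -> _) _]/(_ - _) => E.
have : 0 <= (dg c - df c) * (b - a) by rewrite mulr_ge0// subr_ge0// ltW.
by rewrite -E; lra.
Qed.

End Calculus.

(** * Explicit antiderivatives *)

Section Antiderivatives.
Variable R : realType.
Implicit Types (alpha X Y a c x s t theta p : R).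

Lemma powR_add1 x p : 0 <= x -> 0 < p + 1 -> x `^ (p + 1) = x * x `^ p.
Proof. by move=> x0 p0; rewrite -mulr_powRB1// addrK. Qed.

Lemma is_derive_add (f g : R -> R) t df dg :
  is_derive t 1 f df -> is_derive t 1 g dg ->
  is_derive t 1 (fun t => f t + g t) (df + dg).
Proof. exact: is_deriveD. Qed.

Lemma is_derive_sub (f g : R -> R) t df dg :
  is_derive t 1 f df -> is_derive t 1 g dg ->
  is_derive t 1 (fun t => f t - g t) (df - dg).
Proof. exact: is_deriveB. Qed.

Lemma is_derive_mul (f g : R -> R) t df dg :
  is_derive t 1 f df -> is_derive t 1 g dg ->
  is_derive t 1 (fun t => f t * g t) (f t * dg + g t * df).
Proof. exact: is_deriveM. Qed.

Lemma is_derive_mull (f : R -> R) k t df :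
  is_derive t 1 f df -> is_derive t 1 (fun t => k * f t) (k * df).
Proof. exact: is_deriveZ. Qed.

Lemma is_derive_mulr (f : R -> R) k t df :
  is_derive t 1 f df -> is_derive t 1 (fun t => f t * k) (df * k).
Proof.
move=> D; have := is_derive_mull f k t _ D; rewrite mulrC.
by under eq_fun do rewrite mulrC.
Qed.

Lemma continuous_add (f g : R -> R) :
  continuous f -> continuous g -> continuous (fun t => f t + g t).
Proof. by move=> cf cg t; exact: (cvgD (cf t) (cg t)). Qed.

Lemma continuous_sub (f g : R -> R) :
  continuous f -> continuous g -> continuous (fun t => f t - g t).
Proof. by move=> cf cg t; exact: (cvgB (cf t) (cg t)). Qed.

Lemma continuous_mul (f g : R -> R) :
  continuous f -> continuous g -> continuous (fun t => f t * g t).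
Proof. by move=> cf cg t; exact: (cvgM (cf t) (cg t)). Qed.

Lemma is_derive_affine c a t : is_derive t 1 (fun t => c + t * a) a.
Proof.
have D := is_deriveD (is_derive_cst c t 1)
  (is_deriveM (is_derive_id t 1) (is_derive_cst a t 1)).
by apply: (is_derive_eq D); rewrite scaler0 !add0r /cst [LHS]mulr1.
Qed.

Lemma continuous_affine c a : continuous (fun t => c + t * a).
Proof.
move=> t; apply/differentiable_continuous/derivable1_diffP.
exact: (@ex_derive _ _ _ _ _ _ _ (is_derive_affine c a t)).
Qed.

Lemma is_derive_norm_powR_affine c a p t : 0 < c + t * a ->
  is_derive t 1 (fun t => `|c + t * a| `^ p) (p * (c + t * a) `^ (p - 1) * a).
Proof.
move=> u0.
exact: (@is_derive1_comp R (fun u => `|u| `^ p) (fun t => c + t * a)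
  t _ _ (is_derive_norm_powR R p _ u0) (is_derive_affine c a t)).
Qed.

Lemma continuous_norm_powR_affine c a p : 0 < p ->
  continuous (fun t => `|c + t * a| `^ p).
Proof.
move=> p0 t.
apply: (@continuous_comp _ _ _ (fun t : R => c + t * a) (fun u => `|u| `^ p)).
  exact: continuous_affine.
exact: continuous_norm_powR.
Qed.

(* Every affine argument is spelled [c + t * a], the shape in which
   [is_derive_affine] and [is_derive_norm_powR_affine] apply. *)
Definition mean_primitive x c theta s t : R :=
  (- theta + t * 1) * (x - c) * `|c + t * (x - c)| `^ (s + 1)
  - `|c + t * (x - c)| `^ (s + 2) / (s + 2).

(** Termwise antiderivative on []0, 1[] of [t - theta] times [alpha + X * t]^ s + Y * (1 - t) [^ s];
    the [Y] term writes [t - theta] as [(1 - theta) - (1 - t)]. *)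
Definition weight_primitive alpha X Y theta s t : R :=
  alpha / 2 * ((- theta + t * 1) * (- theta + t * 1))
  + X * (`|0 + t * 1| `^ (s + 2) / (s + 2)
         - theta / (s + 1) * `|0 + t * 1| `^ (s + 1))
  + Y * (`|1 + t * -1| `^ (s + 2) / (s + 2)
         - (1 - theta) / (s + 1) * `|1 + t * -1| `^ (s + 1)).

(** Integration by parts in reverse: the subtracted power cancels the product rule term that comes
    from differentiating [t - theta]. *)
Lemma is_derive_mean_primitive x c theta s t :
  0 < s -> 0 < c + t * (x - c) ->
  is_derive t 1 (mean_primitive x c theta s)
    ((s + 1) * (x - c) ^+ 2 * (t - theta) * (c + t * (x - c)) `^ s).
Proof.
move=> s0 u0.
have D1 := is_derive_norm_powR_affine c (x - c) (s + 1) t u0.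
have D2 := is_derive_norm_powR_affine c (x - c) (s + 2) t u0.
have D3 := is_derive_mulr _ (x - c) t _ (is_derive_affine (- theta) 1 t).
have D := is_derive_sub _ _ t _ _ (is_derive_mul _ _ t _ _ D3 D1)
  (is_derive_mulr _ (s + 2)^-1 t _ D2).
apply: (is_derive_eq D) => {D1 D2 D3 D}.
rewrite (ger0_norm (ltW u0)).
rewrite addrK -[s + 2 - 1]addrA -[2 - 1]/(1 + 1 - 1) addrK.
rewrite powR_add1 ?(ltW u0)//; last lra.
by field; rewrite gt_eqF//; lra.
Qed.

Lemma continuous_mean_primitive x c theta s :
  0 < s -> continuous (mean_primitive x c theta s).
Proof.
move=> s0; apply: continuous_sub; apply: continuous_mul.
- by apply: continuous_mul; [exact: continuous_affine|exact: cst_continuous].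
- by apply: continuous_norm_powR_affine; lra.
- by apply: continuous_norm_powR_affine; lra.
- exact: cst_continuous.
Qed.

Lemma is_derive_weight_primitive alpha X Y theta s t :
  0 < s -> 0 < t < 1 ->
  is_derive t 1 (weight_primitive alpha X Y theta s)
    ((t - theta) * (alpha + X * t `^ s + Y * (1 - t) `^ s)).
Proof.
move=> s0 /andP[t0 t1].
have u0 : 0 < 0 + t * 1 by lra.
have v0 : 0 < 1 + t * -1 by lra.
have L := is_derive_affine (- theta) 1 t.
have S c a k Z (w0 : 0 < c + t * a) := is_derive_mull _ Z t _ (is_derive_sub _ _ t _ _
  (is_derive_mulr _ (s + 2)^-1 t _ (is_derive_norm_powR_affine c a (s + 2) t w0))
  (is_derive_mull _ k t _ (is_derive_norm_powR_affine c a (s + 1) t w0))).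
have D := is_derive_add _ _ t _ _ (is_derive_add _ _ t _ _
  (is_derive_mull _ (alpha / 2) t _ (is_derive_mul _ _ t _ _ L L))
  (S 0 1 (theta / (s + 1)) X u0)) (S 1 (-1) ((1 - theta) / (s + 1)) Y v0).
apply: (is_derive_eq D) => {L S D}.
rewrite !add0r !mulr1 !mulrN1.
rewrite !addrK -[s + 2 - 1]addrA -[2 - 1]/(1 + 1 - 1) addrK.
rewrite !powR_add1 ?subr_ge0 ?(ltW t0) ?(ltW t1)//; [|lra..].
by field; apply/andP; split; rewrite gt_eqF//; lra.
Qed.

Lemma continuous_weight_primitive alpha X Y theta s :
  0 < s -> continuous (weight_primitive alpha X Y theta s).
Proof.
move=> s0.
have N p c a : 0 < p -> continuous (fun t => `|c + t * a| `^ p).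
  exact: continuous_norm_powR_affine.
have S c a k Z : continuous (fun t => Z * (`|c + t * a| `^ (s + 2) / (s + 2)
    - k * `|c + t * a| `^ (s + 1))).
  apply: continuous_mul; first exact: cst_continuous.
  apply: continuous_sub; apply: continuous_mul; try exact: cst_continuous.
  - by apply: N; lra.
  - by apply: N; lra.
apply: continuous_add; last exact: S.
apply: continuous_add; last exact: S.
apply: continuous_mul; first exact: cst_continuous.
by apply: continuous_mul; exact: continuous_affine.
Qed.

(** The left side is the increment on [[theta, 1]] minus the one on [[0, theta]], that is, the
    integral with [|t - theta|] in place of [t - theta]. *)
Lemma weight_primitive_increment alpha X Y theta s :
  0 < s -> 0 <= theta <= 1 ->
  weight_primitive alpha X Y theta s 1 + weight_primitive alpha X Y theta s 0
    - 2 * weight_primitive alpha X Y theta s theta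
  = alpha * A1 theta + X * A2 theta s + Y * A3 theta s.
Proof.
move=> s0 /andP[t0 t1].
rewrite /weight_primitive /A1 /A2 /A3 !mul0r !mulr1 !mulrN1 !add0r !addr0 subrr.
rewrite normr0 normr1 !powR1 !powR0 ?gt_eqF; [|lra..].
rewrite (ger0_norm t0) ger0_norm ?subr_ge0//.
rewrite (_ : s + 2 = s + 1 + 1); last by rewrite -addrA.
rewrite (powR_add1 _ _ t0); last lra.
rewrite (@powR_add1 (1 - theta)) ?subr_ge0//; last lra.
by field; apply/andP; split; rewrite gt_eqF//; lra.
Qed.

End Antiderivatives.

(** * The estimate for one endpoint *)

Section EndpointEstimate.
Variable R : realType.
Implicit Types (alpha x c s t theta q : R).

Lemma A1_gt0 theta : 0 < A1 theta.
Proof. by have := sqr_ge0 (theta - 1 / 2); rewrite /A1 !expr2; lra. Qed.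

Lemma A2_gt0 theta s : 0 < s -> 0 <= theta -> 0 < A2 theta s.
Proof.
move=> s0 t0.
have B := bernoulli_powR R theta (s + 2) t0 ltac:(lra).
have -> : A2 theta s =
    (2 * theta `^ (s + 2) - (s + 2) * theta + (s + 1)) / ((s + 1) * (s + 2)).
  by rewrite /A2; field; apply/andP; split; rewrite gt_eqF//; lra.
apply: divr_gt0; last by apply: mulr_gt0; lra.
move: t0; rewrite le_eqVlt => /predU1P[<-|t0].
  by rewrite powR0 ?gt_eqF//; lra.
have := powR_gt0 (s + 2) t0; lra.
Qed.

(** Subadditivity uses [s * q <= 1]; then [s <= s * q] lets the powers of [t] and [1 - t] in []0,
    1[] drop to exponent [s]. *)
Lemma powR_segment_le x c s q t : 0 < x -> 0 < c -> 0 < s -> 1 <= q ->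
  s * q <= 1 -> 0 < t < 1 ->
  (c + t * (x - c)) `^ (s * q)
    <= x `^ (s * q) * t `^ s + c `^ (s * q) * (1 - t) `^ s.
Proof.
move=> x0 c0 s0 q1 sq /andP[t0 t1].
have t1' : 0 < 1 - t by lra.
have ssq : s <= s * q by rewrite ler_peMr// ltW.
have sq0 : 0 < s * q by rewrite mulr_gt0//; lra.
have -> : c + t * (x - c) = x * t + c * (1 - t) by ring.
apply: le_trans (powRD_le _ _ _ _ (mulr_ge0 (ltW x0) (ltW t0))
  (mulr_ge0 (ltW c0) (ltW t1')) sq0 sq) _.
rewrite !powRM ?(ltW x0) ?(ltW c0) ?(ltW t0) ?(ltW t1')//.
by apply: lerD; apply: ler_wpM2l; rewrite ?powR_ge0//; apply: ger_powR => //; lra.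
Qed.

(* The tangent line of [y `^ (1 / q)] at the weighted average of [y] replaces
   the power mean inequality by a pointwise linear bound. *)
Lemma endpoint_estimate x c s q theta : 0 < x -> 0 < c -> 0 < s -> 1 <= q ->
  s * q <= 1 -> 0 <= theta <= 1 ->
  `| (x - c) * ((1 - theta) * x `^ (s + 1) + theta * c `^ (s + 1))
     - (x `^ (s + 2) - c `^ (s + 2)) / (s + 2) |
  <= (s + 1) * (x - c) ^+ 2 * (A1 theta `^ (1 - 1 / q) *
       (x `^ (s * q) * A2 theta s + c `^ (s * q) * A3 theta s) `^ (1 / q)).
Proof.
move=> x0 c0 s0 q1 sq tt; have /andP[t0 t1] := tt.
set X := x `^ (s * q); set Y := c `^ (s * q).
set N := X * A2 theta s + Y * A3 theta s.
have q0 : 0 < q by lra.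
have r0 : 0 < 1 / q by rewrite divr_gt0.
have r1 : 1 / q <= 1 by rewrite ler_pdivrMr// mul1r.
set r := 1 / q in r0 r1 *.
have qr : s * q * r = s by rewrite /r mul1r -mulrA divff ?mulr1// gt_eqF.
have A1p := A1_gt0 theta.
have N0 : 0 < N.
  apply: addr_gt0; apply: mulr_gt0; try exact: powR_gt0.
    exact: A2_gt0.
  by apply: (A2_gt0 (1 - theta)) => //; rewrite subr_ge0.
set M := N / A1 theta.
have M0 : 0 < M by apply: divr_gt0.
have NM : N = M * A1 theta by rewrite /M divfK// gt_eqF.
set alpha := M `^ r * (1 - r).
set beta := r * M `^ r / M.
have -> : A1 theta `^ (1 - r) * N `^ r
    = alpha * A1 theta + (beta * X) * A2 theta s + (beta * Y) * A3 theta s.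
  have -> : alpha * A1 theta + (beta * X) * A2 theta s + (beta * Y) * A3 theta s
     = alpha * A1 theta + beta * N by rewrite /N; ring.
  have -> : alpha * A1 theta + beta * N = A1 theta * M `^ r.
    by rewrite NM /alpha /beta; field; rewrite gt_eqF.
  rewrite {1}NM powRM ?(ltW M0) ?(ltW A1p)// mulrCA -powRD; last first.
    by rewrite (gt_eqF A1p) implybT.
  by rewrite subrK powRr1 ?(ltW A1p)// mulrC.
have u0 t : 0 < t < 1 -> 0 < c + t * (x - c).
  move=> /andP[h0 h1]; have -> : c + t * (x - c) = t * x + (1 - t) * c by ring.
  by apply: addr_gt0; apply: mulr_gt0 => //; lra.
pose g t := (c + t * (x - c)) `^ s.
pose h t := alpha + beta * X * t `^ s + beta * Y * (1 - t) `^ s.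
have gh t : 0 < t < 1 -> g t <= h t.
  move=> ht; rewrite /g -qr powRrM.
  apply: le_trans (powR_le_tangent _ M _ r (powR_ge0 _ _) M0 r0 r1) _.
  have b0 : 0 <= beta.
    by apply: divr_ge0; [apply: mulr_ge0; [exact: ltW|exact: powR_ge0]|exact: ltW].
  have := ler_wpM2l b0 (powR_segment_le _ _ _ _ _ x0 c0 s0 q1 sq ht).
  by rewrite -/alpha -/beta -/X -/Y /h; lra.
set k := (s + 1) * (x - c) ^+ 2.
have k0 : 0 <= k by rewrite mulr_ge0 ?sqr_ge0//; lra.
rewrite -weight_primitive_increment//.
pose F := mean_primitive R x c theta s.
pose G t := k * weight_primitive R alpha (beta * X) (beta * Y) theta s t.
pose dF t := k * (t - theta) * g t.
pose dG t := k * ((t - theta) * h t).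
have cF : continuous F by exact: continuous_mean_primitive.
have cG : continuous G.
  apply: continuous_mul; first exact: cst_continuous.
  exact: continuous_weight_primitive.
have DF t : 0 < t < 1 -> is_derive t 1 F (dF t).
  by move=> ht; apply: is_derive_mean_primitive => //; exact: u0.
have DG t : 0 < t < 1 -> is_derive t 1 G (dG t).
  by move=> ht; apply: is_derive_mull; apply: is_derive_weight_primitive.
have g0 t : 0 <= g t by exact: powR_ge0.
have lo t : 0 < t < theta -> 0 < t < 1 by move=> /andP[-> ?] /=; lra.
have hi t : theta < t < 1 -> 0 < t < 1 by move=> /andP[? ->]; rewrite andbT; lra.
have c0' (z : R) : continuous (fun _ : R => z) by move=> ?; exact: cst_continuous.
have D0 t : is_derive t 1 (fun=> 0 : R) 0 := is_derive_cst 0 t 1.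
(* The sign of [t - theta] gives [dG <= dF <= 0] before [theta] and [0 <= dF <= dG] after it;
   comparing with the zero function yields the signs of the increments of [F]. *)
have I1 := ler_increment R G F dG dF 0 theta t0 cG cF
  (fun t ht => DG t (lo t ht)) (fun t ht => DF t (lo t ht)).
have I2 := ler_increment R F _ dF _ 0 theta t0 cF (c0' 0)
  (fun t ht => DF t (lo t ht)) (fun t _ => D0 t).
have I3 := ler_increment R F G dF dG theta 1 t1 cF cG
  (fun t ht => DF t (hi t ht)) (fun t ht => DG t (hi t ht)).
have I4 := ler_increment R _ F _ dF theta 1 t1 (c0' 0) cF
  (fun t _ => D0 t) (fun t ht => DF t (hi t ht)).
have {}I1 : G theta - G 0 <= F theta - F 0.
  apply: I1 => t ht; rewrite /dG /dF -mulrA; apply: ler_wpM2l => //.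
  by apply: ler_wnM2l; [lra|exact/gh/lo].
have {}I2 : F theta - F 0 <= 0 - 0.
  apply: I2 => t ht; rewrite /dF -mulrA; apply: mulr_ge0_le0 => //.
  by apply: mulr_le0_ge0 => //; lra.
have {}I3 : F 1 - F theta <= G 1 - G theta.
  apply: I3 => t ht; rewrite /dG /dF -mulrA; apply: ler_wpM2l => //.
  by apply: ler_wpM2l; [lra|exact/gh/hi].
have {}I4 : 0 - 0 <= F 1 - F theta.
  apply: I4 => t ht; rewrite /dF -mulrA; apply: mulr_ge0 => //.
  by apply: mulr_ge0 => //; lra.
have -> : (x - c) * ((1 - theta) * x `^ (s + 1) + theta * c `^ (s + 1))
     - (x `^ (s + 2) - c `^ (s + 2)) / (s + 2) = F 1 - F 0.
  rewrite /F /mean_primitive !mul0r !mul1r addr0 subrKC addr0.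
  by rewrite (gtr0_norm x0) (gtr0_norm c0); ring.
rewrite ler_norml; move: I1 I2 I3 I4; rewrite /G.
set P := weight_primitive _ _ _ _ _ _.
by lra.
Qed.

End EndpointEstimate.

(** * The logarithmic mean and the combination of both endpoints *)

Lemma log_mean_powR (R : realType) (a b s : R) : 0 < a -> a < b -> 0 < s ->
  log_mean (s + 1) a b `^ (s + 1)
    = (b `^ (s + 2) - a `^ (s + 2)) / (s + 2) / (b - a).
Proof.
move=> a0 ab s0.
have ba : 0 < b - a by lra.
have s1 : 0 < s + 1 by lra.
have s2 : 0 < s + 2 by lra.
have b0 : 0 < b by lra.
rewrite /log_mean -powRrM mul1r mulVf ?(gt_eqF s1)// -addrA -[1 + 1]/2 powRr1.
  by rewrite invfM mulrA.
(* The power undoes the root because the quotient is nonnegative. *)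
apply: divr_ge0; last by apply: mulr_ge0; exact: ltW.
by rewrite subr_ge0; apply: ge0_ler_powR; rewrite ?nnegrE ltW.
Qed.

Theorem proposition1 (R : realType) (a b q s lambda theta : R)
    (ha : 0 < a) (hab : a < b) (hq : 1 <= q)
    (hs0 : 0 < s) (hsq : s < 1 / q)
    (hlambda0 : 0 <= lambda) (hlambda1 : lambda <= 1)
    (htheta0 : 0 <= theta) (htheta1 : theta <= 1) :
  `| (1 - theta) * weighted_mean lambda (a `^ (s + 1)) (b `^ (s + 1))
     + theta * (weighted_mean lambda b a) `^ (s + 1)
     - (log_mean (s + 1) a b) `^ (s + 1) |
  <= (b - a) * (A1 theta) `^ (1 - 1 / q) * (s + 1) *
     (lambda ^+ 2 *
        (a `^ (s * q) * A2 theta s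
         + (weighted_mean lambda b a) `^ (s * q) * A3 theta s) `^ (1 / q)
      + (1 - lambda) ^+ 2 *
        (b `^ (s * q) * A2 theta s
         + (weighted_mean lambda b a) `^ (s * q) * A3 theta s) `^ (1 / q)).
Proof.
have q0 : 0 < q by lra.
have sq : s * q <= 1 by apply: ltW; rewrite -ltr_pdivlMr.
have ba : 0 < b - a by rewrite subr_gt0.
have b0 : 0 < b by lra.
set c := weighted_mean lambda b a.
have ca : c - a = lambda * (b - a) by rewrite /c /weighted_mean; ring.
have c0 : 0 < c.
  by have := mulr_ge0 hlambda0 (ltW ba); rewrite -ca; lra.
have bc : b - c = (1 - lambda) * (b - a) by rewrite /c /weighted_mean; ring.
have ac : a - c = - (lambda * (b - a)) by lra.
have tt : 0 <= theta <= 1 by rewrite htheta0.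
have Ea := endpoint_estimate R a c s q theta ha c0 hs0 hq sq tt.
have Eb := endpoint_estimate R b c s q theta b0 c0 hs0 hq sq tt.
rewrite bc in Eb; rewrite ac sqrrN in Ea.
rewrite log_mean_powR//.
(* The endpoint bounds carry [(b - a) ^+ 2], through [(x - c) ^+ 2]; the extra factor [b - a]
   matches this. *)
rewrite -(ler_pM2l ba) -[X in X * `|_|](gtr0_norm ba) -normrM.
set Va := (_ `^ (1 / q)) in Ea *; set Vb := (_ `^ (1 / q)) in Eb *.
set K := A1 theta `^ _ in Ea Eb *.
set Ta := `|_| in Ea; set Tb := `|_| in Eb.
apply: (@le_trans _ _ (Ta + Tb)); last first.
  apply: (le_trans (lerD Ea Eb)); rewrite le_eqVlt; apply/orP; left.
  by apply/eqP; ring.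
rewrite [Ta + Tb]addrC; apply: le_trans (ler_normB _ _).
rewrite le_eqVlt; apply/orP; left.
have s2 : s + 2 != 0 by rewrite gt_eqF//; clear -hs0; lra.
apply/eqP; congr `|_|; clear - ba s2; rewrite /weighted_mean; field.
by rewrite s2 gt_eqF.
Qed.
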